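(* Let $(A,\circ,B(\cdot,\cdot))$ be a quadratic Novikov algebra over $\mathbf{k}$ and let $D:A\to A$ be a linear isomorphism such that $D(a\circ b)=\frac12\,a\circ D(b)$ and $B(D(a),b)=-B(a,D(b))$ for all $a,b\in A$. Then $(A,\circ,\omega(\cdot,\cdot))$ is a quasi-Frobenius Novikov algebra, where $\omega(\cdot,\cdot)$ is defined by $\omega(a,b)=B(D(a),b)$ for all $a,b\in A$.
   Context: $\mathbf{k}$ is a field of characteristic zero; all vector spaces and algebras are finite-dimensional over $\mathbf{k}$. A Novikov algebra $(A,\circ)$ is a vector space with a bilinear operation $\circ$ such that $(a\circ b)\circ c-a\circ(b\circ c)=(b\circ a)\circ c-b\circ(a\circ c)$ and $(a\circ b)\circ c=(a\circ c)\circ b$ for all $a,b,c\in A$. Put $a\star b:=a\circ b+b\circ a$. A quadratic Novikov algebra $(A,\circ,B(\cdot,\cdot))$ is a Novikov algebra with a nondegenerate symmetric bilinear form $B:A\times A\to\mathbf{k}$ such that $B(a\circ b,c)=-B(b,a\star c)$ for all $a,b,c\in A$. A quasi-Frobenius Novikov algebra $(A,\circ,\omega(\cdot,\cdot))$ is a Novikov algebra $(A,\circ)$ with a nondegenerate skewsymmetric bilinear form $\omega$ (skewsymmetric: $\omega(a,b)=-\omega(b,a)$) such that $\omega(a\circ b,c)-\omega(a\star c,b)+\omega(c\circ b,a)=0$ for all $a,b,c\in A$. *)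

(* Defs.v *)
From mathcomp Require Import all_boot all_algebra.
Set Implicit Arguments.
Unset Strict Implicit.
Unset Printing Implicit Defensive.
Import GRing.Theory.
Local Open Scope ring_scope.

Section Novikov.

Variables (k : fieldType) (A : vectType k).

Definition star (op : {bilinear A -> A -> A}) (a b : A) : A := op a b + op b a.

Definition is_novikov (op : {bilinear A -> A -> A}) : Prop :=
  (forall a b c : A,
     op (op a b) c - op a (op b c) = op (op b a) c - op b (op a c)) /\
  (forall a b c : A, op (op a b) c = op (op a c) b).

Definition is_quadratic_novikov
    (op : {bilinear A -> A -> A}) (B : {symmetric A}) : Prop :=
  [/\ is_novikov op, nondegenerate B
    & forall a b c : A, B (op a b) c = - B b (star op a c)].

Definition is_quasi_frobenius_novikov
    (op : {bilinear A -> A -> A}) (omega : {skew_symmetric A}) : Prop :=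
  [/\ is_novikov op, nondegenerate omega
    & forall a b c : A,
        omega (op a b) c - omega (star op a c) b + omega (op c b) a = 0].

End Novikov.

(* Main.v *)
(** The invariance of [B] and [D (a o b) = a o D b / 2] give
    [omega (a o b) c = omega (c o b) a = - B (D b) (a * c) / 2], while the
    skewness of [D] gives [omega (a * c) b = - B (D b) (a * c)], where [*] is
    [star]; so the quasi-Frobenius sum vanishes. *)
Require Import Defs.
From HB Require Import structures.
From mathcomp Require Import all_boot all_algebra.
Import GRing.Theory.
Local Open Scope ring_scope.

(** [nondegenerate] is an equation between subspaces, the orthogonal of [A] being zero; testing it
    on vectors lets it pass from [B] to [omega]. *)
Lemma nondegenerateP (k : fieldType) (eps : bool) (theta : {rmorphism k -> k})
    (A : vectType k) (form : {hermitian A for eps & theta}) :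
  reflect (forall u, (forall v, form u v = 0) -> u = 0) (nondegenerate form).
Proof.
apply: (iffP eqP) => [rad0 u u_rad|form_inj].
  by apply/eqP; rewrite -memv0 -rad0; apply/mem_orthovP => v _; apply: u_rad.
apply/vspaceP => u; rewrite memv0; apply/idP/eqP => [/mem_orthovP u_rad|->].
  by apply: form_inj => v; apply: u_rad; rewrite memvf.
exact: mem0v.
Qed.

Lemma symmetric_formC (k : fieldType) (A : vectType k) (B : {symmetric A}) a b :
  B a b = B b a.
Proof. by rewrite (@hermC _ _ idfun) expr0 mul1r. Qed.

(** Skew because [B (D a) b = - B a (D b) = - B (D b) a], the last step by symmetry of [B]. *)
Lemma skew_twist (k : fieldType) (A : vectType k) (B : {symmetric A})
    (D : {linear A -> A}) (D_skew : forall a b : A, B (D a) b = - B a (D b)) :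
  exists omega : {skew_symmetric A}, forall a b : A, omega a b = B (D a) b.
Proof.
pose f a b := B (D a) b.
(* The scaling laws are those of a sesquilinear form twisted by [idfun] in its second argument, as
   [{skew_symmetric A}] requires. *)
have f_bilinear : bilinear_for
    (GRing.Scale.Law.clone _ _ *%R _)
    (GRing.Scale.Law.clone _ _ (@idfun k \; *%R) _) f.
  split=> [b|a] c x y; rewrite /f /=; first by rewrite linearP linearPl.
  by rewrite linearPr.
have f_skew a b : f a b = (-1) ^+ true * idfun (f b a).
  by rewrite /f D_skew symmetric_formC expr1 mulN1r.
pose omega : {skew_symmetric A} := HB.pack f
  (bilinear_isBilinear.Build k A A k _ _ f f_bilinear)
  (isHermitianSesquilinear.Build k A true idfun f f_skew).
by exists omega.
Qed.

Theorem proposition2p12 (k : fieldType) (char_k : [pchar k] =i pred0)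
    (A : vectType k) (op : {bilinear A -> A -> A}) (B : {symmetric A})
    (quadB : is_quadratic_novikov op B)
    (D : {linear A -> A}) (D_iso : bijective D)
    (D_op : forall a b : A, D (op a b) = 2%:R^-1 *: op a (D b))
    (D_skew : forall a b : A, B (D a) b = - B a (D b)) :
  exists2 omega : {skew_symmetric A},
    (forall a b : A, omega a b = B (D a) b)
    & is_quasi_frobenius_novikov op omega.
Proof.
have [omega omegaE] := skew_twist _ _ _ _ D_skew.
exists omega => //; case: quadB => novikov_op /nondegenerateP B_inj B_op.
split=> // [|a b c].
  (* If [u] is in the radical of [omega], then [D u] is in that of [B]. *)
  apply/nondegenerateP => u u_rad; apply: (bij_inj D_iso); rewrite linear0.
  by apply: B_inj => v; rewrite -omegaE.
have two_neq0 : 2%:R != 0 :> k by have := char_k 2; rewrite !inE /= => ->.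
have omega_op x y z : omega (op x y) z = - (2%:R^-1 * B (D y) (star op x z)).
  by rewrite omegaE D_op linearZl_LR /= B_op mulrN.
have starC : star op c a = star op a c by rewrite /star addrC.
rewrite !omega_op starC omegaE (D_skew (star op a c)) opprK
  (symmetric_formC _ _ _ (star _ _ _)).
(* As [star] is commutative, both outer terms are [- X / 2] and the middle one is [X]; doubling
   clears the halves. *)
set X := B _ _; apply: (mulfI two_neq0).
by rewrite mulr0 !mulrDr !mulrN !mulVKf // mulr_natl mulr2n addKr subrr.
Qed.
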